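(* Let $\mu$ be a $\sigma$-finite positive measure on a set $X$, let $1 \le p \le \infty$, let $m \ge 1$ be an integer, and let $D_1, \ldots, D_m$ be multiplication operators on the complex Banach space $L^p(X,\mu)$ such that $D_1 \cdots D_m = I$. Let $A$ be a bounded linear operator on $L^p(X,\mu)$. Then $$\|A\|^m \le \|D_1 A\| \, \|D_2 A\| \cdots \|D_m A\|.$$ If $A$ is the adjoint operator of an operator, then also $$\|A\|^m \le \|A D_1\| \, \|A D_2\| \cdots \|A D_m\|.$$
   Context: $L^p(X,\mu)$ is the complex Banach space, and $\|\cdot\|$ denotes the operator norm on bounded linear operators on $L^p(X,\mu)$. $I$ is the identity operator. A multiplication operator $D$ on $L^p(X,\mu)$ is an operator of the form $Df = d f$ for all $f \in L^p(X,\mu)$, where $d \in L^\infty(X,\mu)$ is a fixed (complex-valued) function. Let $q \in [1,\infty]$ be the conjugate exponent of $p$, i.e. $1/p + 1/q = 1$ with $1/\infty = 0$. ''$A$ is the adjoint operator of an operator'' means that there is a bounded linear operator $B$ on $L^q(X,\mu)$ with $\int_X (Bf)\, g \, d\mu = \int_X f\, (Ag)\, d\mu$ for all $f \in L^q(X,\mu)$ and $g \in L^p(X,\mu)$. *)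

(* Defs.v *)
From HB Require Import structures.
From mathcomp Require Import all_boot all_order all_algebra.
From mathcomp Require Import generic_quotient ring_quotient complex.
From mathcomp Require Import all_classical all_reals all_analysis.
From mathcomp Require Import ess_sup_inf measurable_realfun.

Set Implicit Arguments.
Unset Strict Implicit.
Unset Printing Implicit Defensive.

Import Order.TTheory GRing.Theory Num.Theory.
Import Normc.

Local Open Scope classical_set_scope.
Local Open Scope ring_scope.
Local Open Scope quotient_scope.

(* Complex-valued measurable functions; [normc z] is the modulus of [z], as an
   element of R (the norm that R[i] itself carries is valued in R[i]). *)
Section complex_functions.
Context d (T : measurableType d) (R : realType).
Variable mu : {measure set T -> \bar R}.
Implicit Types (p : \bar R) (f g : T -> R[i]).

Definition cmeasurable f :=
  measurable_fun setT (fun x => complex.Re (f x)) /\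
  measurable_fun setT (fun x => complex.Im (f x)).

Definition cLnorm p f : \bar R := Lnorm mu p (fun x => (normc (f x))%:E).

Definition cintegral f : R[i] :=
  ((\int[mu]_x complex.Re (f x)) +i* (\int[mu]_x complex.Im (f x)))%C.

Lemma measurable_normc f :
  cmeasurable f -> measurable_fun setT (fun x => normc (f x)).
Proof.
move=> [mr mi].
have -> : (fun x => normc (f x)) =
    (@Num.sqrt R) \o
      (fun x => complex.Re (f x) ^+ 2 + complex.Im (f x) ^+ 2).
  by apply/funext => x /=; case: (f x).
apply: measurableT_comp.
  by apply: continuous_measurable_fun; exact: sqrt_continuous.
by apply: measurable_funD; exact: measurable_funX.
Qed.

Lemma cmeasurable0 : cmeasurable (0 : T -> R[i]).
Proof. by split; exact: measurable_cst. Qed.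

Lemma cmeasurableZD c f g :
  cmeasurable f -> cmeasurable g -> cmeasurable (c *: f + g).
Proof.
move=> [fr fi] [gr gi]; case: c => a b; split.
- rewrite (_ : (fun x => _) = (fun x => a * complex.Re (f x) -
      b * complex.Im (f x) + complex.Re (g x))); last first.
    apply/funext => x; rewrite -[(_ + g) x]/((a +i* b)%C * f x + g x).
    by case: (f x) => ? ?; case: (g x).
  apply: measurable_funD => //; apply: measurable_funB;
    by apply: measurable_funM => //; exact: measurable_cst.
- rewrite (_ : (fun x => _) = (fun x => a * complex.Im (f x) +
      b * complex.Re (f x) + complex.Im (g x))); last first.
    apply/funext => x; rewrite -[(_ + g) x]/((a +i* b)%C * f x + g x).
    by case: (f x) => ? ?; case: (g x).
  apply: measurable_funD => //; apply: measurable_funD;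
    by apply: measurable_funM => //; exact: measurable_cst.
Qed.

Lemma cLnorm_ge0 p f : (0 <= cLnorm p f)%E.
Proof. exact: Lnorm_ge0. Qed.

Lemma ae_le_Lnorm p (u v : T -> R) : (1 <= p)%E ->
  measurable_fun setT u -> measurable_fun setT v ->
  (\forall x \ae mu, `|u x| <= `|v x|) ->
  (Lnorm mu p (fun x => (u x)%:E) <= Lnorm mu p (fun x => (v x)%:E))%E.
Proof.
move=> p1 mU mV uv; rewrite unlock; case: p p1 => [r||//].
- rewrite lee_fin => r1.
  have r0 : 0 <= r by rewrite (le_trans _ r1).
  have mpow (w : T -> R) : measurable_fun setT w ->
      measurable_fun setT (fun x => (`|(w x)%:E| `^ r)%E).
    move=> mw.
    apply: (@measurableT_comp _ _ _ _ _ _ (fun x : \bar R => (x `^ r)%E)) => //.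
      exact: measurable_poweR.
    by apply: measurableT_comp => //; exact/measurable_EFinP.
  apply: gt0_ler_poweR.
  + by rewrite invr_ge0.
  + by rewrite in_itv/= leey andbT integral_ge0// => x _; exact: poweR_ge0.
  + by rewrite in_itv/= leey andbT integral_ge0// => x _; exact: poweR_ge0.
  apply: ae_ge0_le_integral => //.
  + by move=> x _; exact: poweR_ge0.
  + exact: mpow.
  + by move=> x _; exact: poweR_ge0.
  + exact: mpow.
  apply: filterS uv => x uvx _ /=.
  by rewrite lee_fin ge0_ler_powR// nnegrE.
- move=> _; case: ifPn => // _.
  by apply: le_ess_sup; apply: filterS uv => x; rewrite /= lee_fin.
Qed.

Lemma cLnorm0 p : (1 <= p)%E -> cLnorm p 0 = 0%E.
Proof.
move=> p1; rewrite /cLnorm (_ : (fun x => _) = cst 0%E).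
  by apply: Lnorm0; rewrite gt_eqF// (lt_le_trans _ p1).
by apply/funext => x /=; rewrite expr0n /= addr0 sqrtr0.
Qed.

Lemma cLnormD p f g : (1 <= p)%E -> cmeasurable f -> cmeasurable g ->
  (cLnorm p (f + g)%R <= cLnorm p f + cLnorm p g)%E.
Proof.
move=> p1 mf mg.
have mfg : cmeasurable (f + g).
  by rewrite -[f]scale1r; exact: cmeasurableZD.
have [nf ng] := (measurable_normc mf, measurable_normc mg).
apply: le_trans (eminkowski mu nf ng p1).
apply: ae_le_Lnorm => //.
- exact: measurable_normc.
- exact: measurable_funD.
have n0 (z : R[i]) : 0 <= normc z by case: z => a b /=; exact: sqrtr_ge0.
apply: aeW => x /=; rewrite !ger0_norm ?addr_ge0//.
exact: (@le_normcD _ (f x) (g x)).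
Qed.

Lemma cLnormZ p c f : (1 <= p)%E -> cmeasurable f -> (cLnorm p f < +oo)%E ->
  cLnorm p (c *: f)%R = ((normc c)%:E * cLnorm p f)%E.
Proof.
move=> p1 mf lf.
have fL : (fun x => normc (f x)) \in Lfun mu p.
  rewrite inE; apply/andP; split; rewrite inE //=.
  exact: measurable_normc.
have := LnormZ (Lfun_Sub p1 fL) (normc c).
rewrite ger0_norm; last by case: (c) => a b; exact: sqrtr_ge0.
move=> <-; congr Lnorm; apply/funext => x.
by congr EFin; exact: normcM.
Qed.

Lemma cLnorm_ae p f g : (1 <= p)%E -> cmeasurable f -> cmeasurable g ->
  f = g %[ae mu] -> cLnorm p f = cLnorm p g.
Proof.
move=> p1 mf mg fg; apply/eqP; rewrite eq_le; apply/andP; split;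
  apply: ae_le_Lnorm => //; try exact: measurable_normc;
  by apply: filterS fg => x /(_ I) ->.
Qed.

End complex_functions.

(* The R[i]-vector space of measurable functions T -> R[i] with finite L^p
   norm, before identification of almost everywhere equal functions. *)
Section cLfun.
Context d (T : measurableType d) (R : realType).
Variables (mu : {measure set T -> \bar R}) (p : \bar R).

Definition cLfun_pred : {pred T -> R[i]} :=
  [pred f | `[< cmeasurable f /\ (cLnorm mu p f < +oo)%E >]].

(* The proof of 1 <= p is a parameter of the type because the vector space
   structure on it depends on that proof. *)
Record cLfunType (p1 : (1 <= p)%E) := CLfun {
  cLfun_fun :> T -> R[i] ;
  cLfunP : cLfun_fun \in cLfun_pred }.

Variable p1 : (1 <= p)%E.
Local Notation cL := (cLfunType p1).

HB.instance Definition _ := [isSub for @cLfun_fun p1].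
HB.instance Definition _ := [Choice of cL by <:].

Lemma cLfun_submod_closed : submod_closed cLfun_pred.
Proof.
split; first by apply/asboolP; split;
  [exact: cmeasurable0 | rewrite cLnorm0// ltry].
move=> c f g /asboolP[mf lf] /asboolP[mg lg]; apply/asboolP.
have mcf : cmeasurable (c *: f).
  by rewrite -[_ *: _]addr0; apply: cmeasurableZD => //; exact: cmeasurable0.
split; first exact: cmeasurableZD.
apply: (le_lt_trans (cLnormD mu p1 mcf mg)).
rewrite lte_add_pinfty// cLnormZ// lte_mul_pinfty// lee_fin.
by case: (c) => a b; exact: sqrtr_ge0.
Qed.

HB.instance Definition _ :=
  GRing.isSubmodClosed.Build _ _ cLfun_pred cLfun_submod_closed.
HB.instance Definition _ := [SubChoice_isSubLmodule of cL by <:].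

Lemma cLfun_meas (f : cL) : cmeasurable f.
Proof. by have /asboolP[] := cLfunP f. Qed.

Lemma cLfun_fin (f : cL) : (cLnorm mu p f < +oo)%E.
Proof. by have /asboolP[] := cLfunP f. Qed.

Definition aenull : {pred cL} :=
  [pred f : cL | `[< (f : T -> R[i]) = 0 %[ae mu] >]].

Lemma aenull_submod_closed : submod_closed aenull.
Proof.
split; first by apply/asboolP; apply: aeW.
move=> c f g /asboolP f0 /asboolP g0; apply/asboolP.
apply: filterS2 f0 g0 => x /(_ I) fx /(_ I) gx _ /=.
rewrite -[LHS]/(c * f x + g x) fx gx.
by rewrite -[RHS]/(0 : R[i]) -[(0 : T -> R[i]) x]/(0 : R[i]) mulr0 addr0.
Qed.

HB.instance Definition _ :=
  GRing.isSubmodClosed.Build _ _ aenull aenull_submod_closed.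

End cLfun.
Arguments aenull {d T R} mu {p} p1.

(* The complex L^p space, as the quotient by the almost everywhere null
   functions; [Lp_fun u] is a representative of the class [u]. *)
Section Lp.
Context d (T : measurableType d) (R : realType).
Variables (mu : {measure set T -> \bar R}) (p : \bar R) (p1 : (1 <= p)%E).

Definition Lp : Type := Quotient.quot (aenull mu p1).
HB.instance Definition _ := GRing.Zmodule.on Lp.
HB.instance Definition _ := EqQuotient.on Lp.

Definition Lp_fun (u : Lp) : T -> R[i] := repr u : cLfunType mu p1.
Coercion Lp_fun : Lp >-> Funclass.

Lemma Lp_eqP (f g : cLfunType mu p1) :
  \pi_Lp f = \pi_Lp g <-> (f : T -> R[i]) = g %[ae mu].
Proof.
split.
  move/eqP; rewrite -[_ == _]/(\pi_(Quotient.quot _) f == \pi_(Quotient.quot _) g).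
  rewrite -Quotient.idealrBE => /asboolP.
  by apply: filterS => x /(_ I) fg _; apply/eqP; rewrite -subr_eq0; apply/eqP.
move=> fg; apply/eqP.
rewrite -[_ == _]/(\pi_(Quotient.quot _) f == \pi_(Quotient.quot _) g).
rewrite -Quotient.idealrBE; apply/asboolP.
by apply: filterS fg => x /(_ I) fg _; apply/eqP; rewrite subr_eq0; apply/eqP.
Qed.

Lemma Lp_funK (f : cLfunType mu p1) : ((\pi_Lp f : Lp) : T -> R[i]) = f %[ae mu].
Proof. by apply/Lp_eqP; rewrite reprK. Qed.

Definition Lp_scale (c : R[i]) (u : Lp) : Lp := \pi_Lp (c *: repr u).


Lemma pi_scale c f : \pi_Lp (c *: f) = Lp_scale c (\pi_Lp f).
Proof.
apply/Lp_eqP; apply: filterS (Lp_funK f) => x /(_ I) fx _.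
by rewrite -[LHS]/(c * f x) -fx.
Qed.

Lemma pi_LpN f : \pi_Lp (- f) = - \pi_Lp f :> Lp.
Proof. exact: (@Quotient.pi_opp _ (aenull mu p1) f). Qed.

Lemma pi_LpD f g : \pi_Lp (f + g) = \pi_Lp f + \pi_Lp g :> Lp.
Proof. exact: (@Quotient.pi_add _ (aenull mu p1) f g). Qed.

Lemma pi_Lp0 : \pi_Lp 0 = 0 :> Lp.
Proof. by apply: (addrI (\pi_Lp 0)); rewrite -pi_LpD !addr0. Qed.

Lemma Lp_scaleA a b u : Lp_scale a (Lp_scale b u) = Lp_scale (a * b) u.
Proof.
rewrite -[u]reprK; move: (repr u) => f.
by rewrite -(pi_scale b f) -(pi_scale a) -(pi_scale (a * b)) scalerA.
Qed.

Lemma Lp_scale1 : left_id 1 Lp_scale.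
Proof.
move=> u; rewrite -[u]reprK; move: (repr u) => f.
by rewrite -(pi_scale 1 f) scale1r.
Qed.

Lemma Lp_scaleDr : right_distributive Lp_scale +%R.
Proof.
move=> c u v; rewrite -[u]reprK -[v]reprK; move: (repr u) (repr v) => f g.
rewrite -(pi_LpD f g) -(pi_scale c f) -(pi_scale c g) -(pi_scale c (f + g)).
by rewrite -pi_LpD scalerDr.
Qed.

Lemma Lp_scaleDl u : {morph Lp_scale^~ u : a b / a + b}.
Proof.
move=> a b; rewrite -[u]reprK; move: (repr u) => f.
rewrite -(pi_scale a f) -(pi_scale b f) -(pi_scale (a + b) f).
by rewrite -pi_LpD scalerDl.
Qed.

HB.instance Definition _ := GRing.Zmodule_isLmodule.Build R[i] Lp
  Lp_scaleA Lp_scale1 Lp_scaleDr Lp_scaleDl.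

(* The norm `|u| of [Lp] is valued in R, although the scalars are in R[i]. *)
Definition Lp_norm (u : Lp) : R := fine (cLnorm mu p u).

Lemma Lp_norm_fin (f : cLfunType mu p1) : cLnorm mu p f \is a fin_num.
Proof. by rewrite ge0_fin_numE ?cLnorm_ge0// cLfun_fin. Qed.

Lemma Lp_norm_pi f : Lp_norm (\pi_Lp f) = fine (cLnorm mu p f).
Proof.
by congr fine; apply: cLnorm_ae => //;
  [exact: cLfun_meas | exact: cLfun_meas | exact: Lp_funK].
Qed.

Lemma Lp_normD u v : Lp_norm (u + v) <= Lp_norm u + Lp_norm v.
Proof.
rewrite -[u]reprK -[v]reprK -pi_LpD !Lp_norm_pi.
rewrite -fineD ?Lp_norm_fin// fine_le ?fin_numD ?Lp_norm_fin//.
by apply: cLnormD => //; exact: cLfun_meas.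
Qed.

Lemma Lp_normZ c u : Lp_norm (c *: u) = normc c * Lp_norm u.
Proof.
rewrite -[u]reprK -[_ *: _]pi_scale !Lp_norm_pi.
by rewrite cLnormZ ?fineM ?Lp_norm_fin//; [exact: cLfun_meas|exact: cLfun_fin].
Qed.

Lemma Lp_norm0_eq0 u : Lp_norm u = 0 -> u = 0.
Proof.
rewrite -[u]reprK Lp_norm_pi -pi_Lp0; set f := repr u => f0.
have {f0} : cLnorm mu p f = 0%E by rewrite -[LHS]fineK ?Lp_norm_fin// f0.
move=> /Lnorm_eq0_eq0 f0; apply/Lp_eqP.
have {f0} := f0 _ (lt_le_trans lte01 p1).
have mf : measurable_fun setT (fun x => (normc (f x))%:E).
  by apply/measurable_EFinP; exact: measurable_normc (cLfun_meas f).
move=> /(_ mf); apply: filterS => x /(_ I) [fx] _.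
exact: eq0_normc.
Qed.

Lemma Lp_normMn u n : Lp_norm (u *+ n) = Lp_norm u *+ n.
Proof.
rewrite -[u *+ n]scaler_nat Lp_normZ.
by rewrite (normcMn (1 : Rcomplex R)) normc1 mulr_natl.
Qed.

Lemma Lp_normN u : Lp_norm (- u) = Lp_norm u.
Proof. by rewrite -scaleN1r Lp_normZ (normcN (1 : Rcomplex R)) normc1 mul1r. Qed.

HB.instance Definition _ := Num.Zmodule_isNormed.Build R Lp
  Lp_normD Lp_norm0_eq0 Lp_normMn Lp_normN.

End Lp.
Arguments Lp {d T R} mu {p} p1.

Section operators.
Context (R : realType).

Definition bounded_op (V W : normedZmodType R) (F : V -> W) :=
  exists M : R, forall u, `|F u| <= M * `|u|.

(* A genuine supremum only for a bounded [F]; [sup] is 0 otherwise. *)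
Definition op_norm (V W : normedZmodType R) (F : V -> W) : R :=
  sup [set `|F u| | u in [set u : V | `|u| <= 1]].

Context d (T : measurableType d).
Variables (mu : {measure set T -> \bar R}) (p : \bar R) (p1 : (1 <= p)%E).

Definition multiplication_op (D : Lp mu p1 -> Lp mu p1) :=
  exists h : Lp mu (leey 1%E), forall f : Lp mu p1,
    (D f : T -> R[i]) = (fun x => h x * f x) %[ae mu].

Definition adjoint_op (A : Lp mu p1 -> Lp mu p1) :=
  let q1 := hoelder_conj_ge1 p1 in
  exists B : {linear Lp mu q1 -> Lp mu q1},
    bounded_op B /\
    forall (f : Lp mu q1) (g : Lp mu p1),
      cintegral mu (fun x => Lp_fun (B f) x * g x) = cintegral mu (fun x => f x * A g x).

End operators.

(* Main.v *)
Require Import Defs.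
From mathcomp Require Import all_boot all_order all_algebra.
From mathcomp Require Import complex.
From mathcomp Require Import all_classical all_reals all_analysis.
From mathcomp Require Import ess_sup_inf measurable_realfun ring.
Import Order.TTheory GRing.Theory Num.Theory.
Import Normc numFieldNormedType.Exports.

Set Implicit Arguments.
Unset Strict Implicit.
Unset Printing Implicit Defensive.

Local Open Scope classical_set_scope.
Local Open Scope ring_scope.
Local Open Scope quotient_scope.

(** Each [D i] multiplies by some [h i], and [D_1 ... D_m = I] forces
[\prod_i h i = 1] almost everywhere on the support of every element of L^p.
For weights [t i > 0] with [\prod_i t i = 1], the arithmetic-geometric mean
inequality then gives, at almost every point of the support,
[1 = \prod_i (t i * |h i|) ^ (1/m) <= m^-1 * \sum_i t i * |h i|]
([normc_le_weighted_mean]).  Both inequalities of the theorem follow from the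
linear estimate

  [|A| <= m^-1 * \sum_i t i * c i],  [c i] being [|D i A|] or [|A D i|],

since the choice [t i = (\prod_j c j) ^ (1/m) / c i] makes the right-hand side
equal to the geometric mean of the [c i]
([expr_le_prod_of_weighted_mean]; a small constant is added to the [c i] to
allow some of them to vanish).  Working with linear estimates replaces the
generalized Hoelder inequality by the triangle inequality, uniformly in [p].

For [D i A], the pointwise bound applied to [u = A g] says that |u| is at most
the mean of the |D i u|.  Multiplying each [D i u] by a phase (or 0) turns
this mean into the modulus of one element of L^p, so that the triangle
inequality applies ([norm_le_weighted_mean]).

For [A D i], let [A] be the adjoint of [B], and take [f] in L^q and [g] in L^p.
The phases can be chosen ([weighted_rotation]) so that, for some [v i] of
norm at most that of [g], the element [G = m^-1 * \sum_i t i * D i (v i)]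
satisfies [|B f * g| <= Re (B f * G)] almost everywhere.  Hence
[Re \int f * A g = Re \int B f * g <= Re \int B f * G = Re \int f * A G], and
Hoelder's inequality bounds the last integral by
[|f| * |A G| <= |f| * (m^-1 * \sum_i t i * |A D i|) * |g|].
The converse of Hoelder's inequality ([converse_hoelder], which uses
sigma-finiteness when [p = +oo]) turns this into a bound of |A g|. *)

(** * Weighted arithmetic and geometric means *)

Section reals.
Context {R : realType}.

Lemma le_prod_addgt0 (m : nat) (x : R) (c : 'I_m -> R) :
  (forall e, 0 < e -> x <= \prod_i (c i + e)) -> x <= \prod_i c i.
Proof.
move=> xe.
pose P : {poly R} := \prod_i ((c i)%:P + 'X).
have PE e : P.[e] = \prod_i (c i + e).
  by rewrite horner_prod; apply: eq_bigr => i _; rewrite hornerD hornerC hornerX.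
have -> : \prod_i c i = P.[0].
  by rewrite PE; apply: eq_bigr => i _; rewrite addr0.
apply: (@cvgr_to_ge _ (0^'+) _ _ (horner P)).
  by apply: cvg_at_right_filter; exact: continuous_horner.
near=> e; rewrite PE; apply: xe; near: e; exact: nbhs_right_gt.
Unshelve. all: by end_near. Qed.

(** The infimum over the weights of the weighted arithmetic means of the [c i]
is their geometric mean; the optimal weights are inversely proportional to the
[c i]. *)
Lemma expr_le_prod_of_weighted_mean (m : nat) (a : R) (c : 'I_m -> R) :
  (0 < m)%N -> 0 <= a -> (forall i, 0 <= c i) ->
  (forall t : 'I_m -> R, (forall i, 0 < t i) -> \prod_i t i = 1 ->
     a <= \sum_i t i / m%:R * c i) ->
  a ^+ m <= \prod_i c i.
Proof.
move=> m0 a0 c0 H; apply: le_prod_addgt0 => e e0.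
have ce i : 0 < c i + e by rewrite ltr_wpDl.
(* The geometric mean of the [c i + e], from which the optimal weights are
   obtained. *)
pose g := (\prod_i (c i + e)) `^ (m%:R^-1).
have P0 : 0 < \prod_i (c i + e) by exact: prodr_gt0.
have g0 : 0 < g by rewrite powR_gt0.
have gm : g ^+ m = \prod_i (c i + e).
  rewrite -powR_mulrn ?ltW// -powRrM mulVf ?powRr1 ?ltW//.
  by rewrite pnatr_eq0 -lt0n.
have mR : m%:R != 0 :> R by rewrite pnatr_eq0 -lt0n.
rewrite -gm lerXn2r ?nnegrE ?(ltW g0)//.
apply: le_trans (H (fun i => g / (c i + e)) _ _) _.
- by move=> i; rewrite divr_gt0.
- rewrite big_split/= prodfV prodr_const card_ord gm divff//.
  by rewrite gt_eqF.
- apply: (@le_trans _ _ (\sum_(i < m) g / m%:R)).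
    apply: ler_sum => i _.
    have -> : g / (c i + e) / m%:R * c i = g / m%:R * (c i / (c i + e)) by ring.
    rewrite ler_piMr ?divr_ge0 ?(ltW g0)//.
    by rewrite ler_pdivrMr// mul1r lerDl ltW.
  by rewrite sumr_const card_ord -[leLHS]mulr_natr divfK.
Qed.

Lemma weighted_mean_ge1 (m : nat) (t x : 'I_m -> R) : (0 < m)%N ->
  (forall i, 0 < t i) -> \prod_i t i = 1 ->
  (forall i, 0 <= x i) -> \prod_i x i = 1 ->
  1 <= \sum_i t i / m%:R * x i.
Proof.
move=> m0 t0 tp x0 xp.
have tx i : 0 <= t i * x i by rewrite mulr_ge0// ltW.
have [H _] := @leif_AGM R 'I_m xpredT (fun i => t i * x i) (fun i _ => tx i).
move: H; rewrite big_split/= tp xp mulr1 /= card_ord.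
have -> : (\sum_i t i * x i) / m%:R = \sum_i t i / m%:R * x i.
  by rewrite mulr_suml; apply: eq_bigr => i _; rewrite mulrAC.
set s := \sum_i _ => H.
have s0 : 0 <= s.
  by apply: sumr_ge0 => i _; rewrite mulr_ge0// divr_ge0// ltW.
by rewrite -[leLHS](expr1n _ m) ler_pXn2r ?nnegrE in H.
Qed.

End reals.

(** * Phases of complex numbers *)

Section phase.
Context {R : realType}.
Implicit Types z w : R[i].

Lemma normc_ge0 z : 0 <= normc z.
Proof. by case: z => a b /=; exact: sqrtr_ge0. Qed.

Lemma normc_prod (I : Type) (r : seq I) (F : I -> R[i]) :
  normc (\prod_(i <- r) F i) = \prod_(i <- r) normc (F i).
Proof. by elim/big_rec2: _ => [|i x y _ <-]; rewrite ?normc1 ?normcM. Qed.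

Lemma normc_real (a : R) : normc a%:C%C = `|a|.
Proof. by rewrite /= expr0n addr0 sqrtr_sqr. Qed.

(** The conjugate of the phase of [z], and 0 at [z = 0]. *)
Definition csgn z : R[i] := (conjc z * ((normc z)^-1)%:C)%C.

Lemma mul_csgn z : csgn z * z = (normc z)%:C%C.
Proof.
have [z0|z0] := eqVneq (normc z) 0.
  by rewrite z0 (eq0_normc z0) mulr0.
have n2 : normc z ^+ 2 = complex.Re z ^+ 2 + complex.Im z ^+ 2.
  by case: z {z0} => a b /=; rewrite sqr_sqrtr// addr_ge0 ?sqr_ge0.
rewrite /csgn mulrAC.
have -> : conjc z * z = (normc z ^+ 2)%:C%C.
  rewrite n2; case: z {z0 n2} => a b; apply/eqP; rewrite eq_complex /=.
  by apply/andP; split; apply/eqP; ring.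
by rewrite -rmorphM /= expr2 mulfK.
Qed.

Lemma normc_csgn_le1 z : normc (csgn z) <= 1.
Proof.
have [z0|z0] := eqVneq (normc z) 0.
  by rewrite (eq0_normc z0) /csgn normcM normc0 invr0 -normcM mulr0 normc0 ler01.
have /(congr1 (@normc R)) := mul_csgn z.
rewrite normcM normc_real ger0_norm ?normc_ge0// => H.
by rewrite -(ler_pM2r (_ : 0 < normc z)) ?mul1r ?H// lt_def z0 normc_ge0.
Qed.

Lemma Re_le_normc z : `|complex.Re z| <= normc z.
Proof.
case: z => a b /=; rewrite -sqrtr_sqr ler_sqrt ?lerDl ?sqr_ge0//.
by rewrite addr_ge0 ?sqr_ge0.
Qed.

End phase.

(** * Elements of L^p and multiplication operators *)

Section cmeasurable.
Context d (T : measurableType d) (R : realType).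
Implicit Types f g : T -> R[i].

Lemma cmeasurableM f g :
  cmeasurable f -> cmeasurable g -> cmeasurable (fun x => f x * g x).
Proof.
move=> [fr fi] [gr gi]; split.
- rewrite (_ : (fun x => _) = (fun x => complex.Re (f x) * complex.Re (g x) -
      complex.Im (f x) * complex.Im (g x))); last first.
    by apply/funext => x; case: (f x) => ? ?; case: (g x).
  by apply: measurable_funB; exact: measurable_funM.
- rewrite (_ : (fun x => _) = (fun x => complex.Re (f x) * complex.Im (g x) +
      complex.Im (f x) * complex.Re (g x))); last first.
    by apply/funext => x; case: (f x) => ? ?; case: (g x).
  by apply: measurable_funD; exact: measurable_funM.
Qed.

Lemma cmeasurable_real (u : T -> R) :
  measurable_fun setT u -> cmeasurable (fun x => (u x)%:C%C).
Proof. by move=> mu; split => //=; exact: measurable_cst. Qed.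

Lemma cmeasurable_csgn f : cmeasurable f -> cmeasurable (fun x => csgn (f x)).
Proof.
move=> mf; apply: cmeasurableM.
  case: mf => fr fi; split.
    rewrite (_ : (fun x => _) = (fun x => complex.Re (f x)))//.
    by apply/funext => x; case: (f x).
  rewrite (_ : (fun x => _) = (fun x => - complex.Im (f x))).
    exact: measurableT_comp.
  by apply/funext => x; case: (f x).
apply: cmeasurable_real.
rewrite (_ : (fun x => _) = (fun x => normc (f x) `^ (-1))).
  by apply: (measurableT_comp (measurable_powR _)); exact: measurable_normc.
by apply/funext => x; rewrite powR_inv1// normc_ge0.
Qed.

End cmeasurable.

Section Lp_elements.
Context d (T : measurableType d) (R : realType) (mu : {measure set T -> \bar R}).
Context (p : \bar R) (p1 : (1 <= p)%E).
Implicit Types (u v w : Lp mu p1) (f : T -> R[i]).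

Lemma Lp_meas u : cmeasurable u. Proof. exact: cLfun_meas. Qed.

Lemma Lp_normrZ (c : R[i]) u : `|c *: u| = normc c * `|u|.
Proof. exact: Lp_normZ. Qed.

Lemma Lp_normE u : `|u|%:E = cLnorm mu p u.
Proof. by rewrite -[LHS]/((fine _)%:E) fineK// Lp_norm_fin. Qed.

Lemma Lp_norm_le u v :
  (\forall x \ae mu, normc (u x) <= normc (v x)) -> `|u| <= `|v|.
Proof.
move=> uv; rewrite -lee_fin !Lp_normE; apply: ae_le_Lnorm => //.
- exact: measurable_normc (Lp_meas u).
- exact: measurable_normc (Lp_meas v).
- by apply: filterS uv => x; rewrite !ger0_norm ?normc_ge0.
Qed.

Lemma Lp_of_fun f : cmeasurable f -> (cLnorm mu p f < +oo)%E ->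
  exists2 u : Lp mu p1, (u : T -> R[i]) = f %[ae mu] & `|u|%:E = cLnorm mu p f.
Proof.
move=> mf lf; have Pf : f \in cLfun_pred mu p by apply/asboolP.
exists (\pi_(Lp mu p1) (CLfun p1 Pf)); first exact: Lp_funK.
by rewrite -[`|_|]/(Lp_norm _) Lp_norm_pi fineK ?Lp_norm_fin.
Qed.

(** Produces the elements [k * u] of L^p for a measurable [k] bounded by 1,
in particular for a phase. *)
Lemma Lp_dominated f u : cmeasurable f ->
  (\forall x \ae mu, normc (f x) <= normc (u x)) ->
  exists2 w : Lp mu p1, (w : T -> R[i]) = f %[ae mu] & `|w| <= `|u|.
Proof.
move=> mf fu.
have lf : (cLnorm mu p f <= `|u|%:E)%E.
  rewrite Lp_normE; apply: ae_le_Lnorm => //.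
  - exact: measurable_normc.
  - exact: measurable_normc (Lp_meas u).
  - by apply: filterS fu => x; rewrite !ger0_norm ?normc_ge0.
have [w wf wn] := Lp_of_fun mf (le_lt_trans lf (ltry _)).
by exists w => //; rewrite -lee_fin wn.
Qed.

Lemma Lp_funZ (c : R[i]) u : (c *: u : Lp mu p1) = (fun x => c * u x) %[ae mu].
Proof. exact: Lp_funK. Qed.

Lemma Lp_funD u v : (u + v : Lp mu p1) = (fun x => u x + v x) %[ae mu].
Proof.
have -> : u + v = \pi_(Lp mu p1) (repr u + repr v) by rewrite pi_LpD !reprK.
exact: Lp_funK.
Qed.

Lemma Lp_fun0 : ((0 : Lp mu p1) : T -> R[i]) = (fun=> 0) %[ae mu].
Proof. by rewrite -pi_Lp0; exact: Lp_funK. Qed.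

Lemma Lp_fun_sum (m : nat) (F : 'I_m -> Lp mu p1) :
  (\sum_i F i : Lp mu p1) = (fun x => \sum_i F i x) %[ae mu].
Proof.
elim: m F => [|m IH] F.
  rewrite big_ord0; apply: filterS Lp_fun0 => x /(_ I) -> _.
  by rewrite big_ord0.
rewrite big_ord_recl.
apply: filterS2 (Lp_funD (F ord0) (\sum_i F (lift ord0 i)))
  (IH (fun i => F (lift ord0 i))).
by move=> x /(_ I) -> /(_ I) -> _; rewrite big_ord_recl.
Qed.

Lemma norm_Lp_sum_le (m : nat) (v : 'I_m -> Lp mu p1) (a c : 'I_m -> R) :
  (forall i, 0 <= a i) -> (forall i, `|v i| <= c i) ->
  `|\sum_i (a i)%:C%C *: v i| <= \sum_i a i * c i.
Proof.
move=> a0 vc; apply: le_trans (ler_norm_sum _ _ _) _.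
apply: ler_sum => i _.
by rewrite Lp_normrZ normc_real ger0_norm// ler_wpM2l.
Qed.

End Lp_elements.

Section multiplication.
Context d (T : measurableType d) (R : realType) (mu : {measure set T -> \bar R}).
Context (p : \bar R) (p1 : (1 <= p)%E).

Lemma Linfty_bounded (h : Lp mu (leey 1%E)) :
  exists2 C : R, 0 <= C & \forall x \ae mu, normc (h x) <= C.
Proof.
have : (cLnorm mu +oo h < +oo)%E by exact: cLfun_fin.
rewrite /cLnorm unlock; case: ifPn => [mu0|].
  move=> /(@ess_supr_bounded _ _ _ mu (fun x => `|normc (h x)|)) [M hM].
  exists `|M| => //; apply: filterS hM => x.
  by rewrite ger0_norm ?normc_ge0// => /le_trans; apply; rewrite ler_norm.
rewrite -leNgt => mu0 _; exists 0 => //.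
exists setT; split => //; apply/eqP; rewrite eq_le mu0//=.
Qed.

(** Makes the operators [D i \o A] and [A \o D i] bounded, so that their
[op_norm] is a genuine supremum. *)
Lemma multiplication_bounded (D : Lp mu p1 -> Lp mu p1) :
  multiplication_op D -> exists2 C, 0 <= C & forall u, `|D u| <= C * `|u|.
Proof.
move=> [h hD]; have [C C0 hC] := Linfty_bounded h.
exists C => // u.
have -> : C * `|u| = `|C%:C%C *: u|.
  by rewrite Lp_normrZ normc_real ger0_norm.
apply: Lp_norm_le.
apply: filterS3 hC (hD u) (Lp_funZ C%:C%C u) => x hx /(_ I) -> /(_ I) ->.
by rewrite !normcM normc_real (ger0_norm C0) ler_wpM2r ?normc_ge0.
Qed.

Lemma comp_multiplication (m : nat) (D : 'I_m -> Lp mu p1 -> Lp mu p1)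
    (h : 'I_m -> Lp mu (leey 1%E)) :
  (forall i u, (D i u : T -> R[i]) = (fun x => h i x * u x) %[ae mu]) ->
  forall u, ((\big[(fun F G => F \o G)/idfun]_(i < m) D i) u : T -> R[i]) =
    (fun x => (\prod_i h i x) * u x) %[ae mu].
Proof.
move=> hD u; elim: m D h hD => [|m IH] D h hD.
  rewrite big_ord0; apply: aeW => x _ /=.
  by rewrite big_ord0 mul1r.
rewrite big_ord_recl /=; set v := (X in D ord0 X).
have vE : (v : T -> R[i]) = (fun x => \prod_i h (lift ord0 i) x * u x) %[ae mu].
  by apply: IH => i; exact: hD.
apply: filterS2 (hD ord0 v) vE => x /(_ I) -> /(_ I) -> _.
by rewrite big_ord_recl mulrA.
Qed.

End multiplication.

(** * Operator norms *)

Section op_norm.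
Context d (T : measurableType d) (R : realType) (mu : {measure set T -> \bar R}).
Context (p : \bar R) (p1 : (1 <= p)%E).
Implicit Types (F : Lp mu p1 -> Lp mu p1) (u : Lp mu p1).

Lemma op_norm_ge0 F : 0 <= op_norm F.
Proof.
have [supF|/sup_out] :=
  pselect (has_sup [set `|F u| | u in [set u : Lp mu p1 | `|u| <= 1]]).
  apply: (@le_trans _ _ `|F 0|) => //.
  by apply: sup_upper_bound => //; exists 0 => //=; rewrite normr0.
by rewrite /op_norm => ->.
Qed.

Lemma le_op_norm F u : bounded_op F ->
  (forall (c : R[i]) v, F (c *: v) = c *: F v) -> `|F u| <= op_norm F * `|u|.
Proof.
move=> [M FM] FZ.
have Zn (c : R) (v : Lp mu p1) : 0 <= c -> `|c%:C%C *: v| = c * `|v|.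
  by move=> c0; rewrite Lp_normrZ normc_real ger0_norm.
have [u0|u0] := eqVneq u 0.
  have /eqP -> : F u == 0.
    rewrite -normr_le0; apply: le_trans (FM u) _.
    by rewrite u0 normr0 mulr0.
  by rewrite normr0 mulr_ge0// op_norm_ge0.
have nu : 0 < `|u| by rewrite normr_gt0.
rewrite -ler_pdivrMr//.
apply: ub_le_sup => /=.
  exists `|M| => _ [v v1 <-]; apply: le_trans (FM v) _.
  apply: le_trans (ler_wpM2r (normr_ge0 _) (ler_norm M)) _.
  by rewrite ler_piMr.
exists (((`|u|)^-1)%:C%C *: u) => /=.
  by rewrite Zn ?invr_ge0// mulVf// gt_eqF.
by rewrite FZ Zn ?invr_ge0// mulrC.
Qed.

Lemma op_norm_le F (M : R) : 0 <= M ->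
  (forall u, `|F u| <= M * `|u|) -> op_norm F <= M.
Proof.
move=> M0 FM; apply: ge_sup.
  by exists `|F 0|, 0 => //=; rewrite normr0.
by move=> _ [u u1 <-]; apply: le_trans (FM u) _; rewrite ler_piMr.
Qed.

End op_norm.

(** * The weighted mean of multiplication operators with product I *)

Section weighted_mean.
Context d (T : measurableType d) (R : realType) (mu : {measure set T -> \bar R}).
Context (p : \bar R) (p1 : (1 <= p)%E) (m : nat).
Context (D : 'I_m -> Lp mu p1 -> Lp mu p1) (h : 'I_m -> Lp mu (leey 1%E)).
Implicit Types u : Lp mu p1.
Hypothesis m_gt0 : (0 < m)%N.
Hypothesis Dh : forall i u,
  (D i u : T -> R[i]) = (fun x => h i x * u x) %[ae mu].
Hypothesis prodD : forall u,
  (\big[(fun F G : Lp mu p1 -> Lp mu p1 => F \o G)/idfun]_(i < m) D i) u = u.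
Variable t : 'I_m -> R.
Hypothesis t_gt0 : forall i, 0 < t i.
Hypothesis prodt : \prod_i t i = 1.

(** Where [u] does not vanish, [prodD] applied to [u] itself gives
[\prod_i h i = 1], and the arithmetic-geometric mean inequality applies. *)
Lemma normc_le_weighted_mean (u : Lp mu p1) : \forall x \ae mu,
  normc (u x) <= \sum_i t i / m%:R * (normc (h i x) * normc (u x)).
Proof.
have := comp_multiplication Dh u; rewrite prodD.
apply: filterS => x /(_ I) hu.
have [u0|u0] := eqVneq (u x) 0.
  by rewrite u0 normc0; apply: sumr_ge0 => i _; rewrite mulr0 mulr0.
have h1 : \prod_i normc (h i x) = 1.
  rewrite -normc_prod (_ : \prod_i h i x = 1) ?normc1//.
  by apply: (mulIf u0); rewrite mul1r -hu.
under eq_bigr do rewrite mulrA.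
rewrite -mulr_suml ler_peMl ?normc_ge0//.
by apply: weighted_mean_ge1 => // i; exact: normc_ge0.
Qed.

Lemma weight_ge0 i : 0 <= t i / m%:R.
Proof. by rewrite divr_ge0// ltW. Qed.

(** Rotating each [D i u] to the nonnegative element [|D i u|] makes the
pointwise mean of the moduli the modulus of a sum in L^p. *)
Lemma norm_le_weighted_mean u : `|u| <= \sum_i t i / m%:R * `|D i u|.
Proof.
have /fin_all_exists2[v vE vn] i : exists2 v : Lp mu p1,
    (v : T -> R[i]) = (fun x => csgn (D i u x) * D i u x) %[ae mu] &
    `|v| <= `|D i u|.
  apply: Lp_dominated.
    by apply: cmeasurableM; [apply: cmeasurable_csgn|]; exact: Lp_meas.
  by apply: aeW => x; rewrite normcM ler_piMl ?normc_ge0// normc_csgn_le1.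
apply: le_trans (norm_Lp_sum_le weight_ge0 vn); apply: Lp_norm_le.
pose w i : Lp mu p1 := (t i / m%:R)%:C%C *: v i.
have wE i : (w i : T -> R[i]) =
    (fun x => (t i / m%:R * (normc (h i x) * normc (u x)))%:C%C) %[ae mu].
  apply: filterS3 (Lp_funZ (t i / m%:R)%:C%C (v i)) (vE i) (Dh i u).
  move=> x /(_ I) -> /(_ I) -> /(_ I) Dx _.
  by rewrite mul_csgn Dx normcM -rmorphM.
have wA := filter_forall (ae_filter_ringOfSetsType mu) wE.
apply: filterS3 (normc_le_weighted_mean u) (Lp_fun_sum w) wA.
move=> x ux /(_ I) -> wx; under eq_bigr do rewrite (wx _ I).
by rewrite -rmorph_sum normc_real; exact: le_trans (ler_norm _).
Qed.

(** The dual form of [norm_le_weighted_mean]: as [b * D i (k * u)] equals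
[k * (b * h i * u)] almost everywhere, the phase [k] of the conjugate of
[b * h i * u] can be applied to [u] before [D i]. This leaves [D i] as the last
operator, so that a further operator can be composed with it. *)
Lemma weighted_rotation (p' : \bar R) (p1' : (1 <= p')%E) (b : Lp mu p1') u :
  exists2 v : 'I_m -> Lp mu p1, forall i, `|v i| <= `|u| &
    \forall x \ae mu, normc (b x * u x) <=
      complex.Re (b x * Lp_fun (\sum_i (t i / m%:R)%:C%C *: D i (v i)) x).
Proof.
have /fin_all_exists2[v vE vn] i : exists2 v : Lp mu p1,
    (v : T -> R[i]) = (fun x => csgn (b x * (h i x * u x)) * u x) %[ae mu] &
    `|v| <= `|u|.
  apply: Lp_dominated.
    apply: cmeasurableM; last exact: Lp_meas.
    apply: cmeasurable_csgn; apply: cmeasurableM; first exact: Lp_meas.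
    by apply: cmeasurableM; exact: Lp_meas.
  by apply: aeW => x; rewrite normcM ler_piMl ?normc_ge0// normc_csgn_le1.
exists v => //.
pose w i : Lp mu p1 := (t i / m%:R)%:C%C *: D i (v i).
have wE i : \forall x \ae mu, b x * w i x =
    (t i / m%:R * (normc (h i x) * normc (u x)) * normc (b x))%:C%C.
  apply: filterS3 (Lp_funZ (t i / m%:R)%:C%C (D i (v i))) (vE i) (Dh i (v i)).
  move=> x /(_ I) wx /(_ I) vx /(_ I) Dx.
  rewrite wx Dx vx.
  pose z := b x * (h i x * u x).
  rewrite -/z [LHS](_ : _ = (t i / m%:R)%:C%C * (csgn z * z)).
    rewrite mul_csgn /z !normcM -rmorphM; congr (_ %:C%C).
    by rewrite -[RHS]mulrA [X in _ = _ * X]mulrC.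
  by rewrite /z; ring.
have wA := filter_forall (ae_filter_ringOfSetsType mu) wE.
apply: filterS3 (normc_le_weighted_mean u) (Lp_fun_sum w) wA.
move=> x ux /(_ I) -> wx; rewrite mulr_sumr; under eq_bigr do rewrite wx.
rewrite -rmorph_sum /= -mulr_suml normcM mulrC.
by rewrite ler_wpM2r ?normc_ge0.
Qed.

End weighted_mean.

(** * Hoelder's inequality and its converse for complex functions *)

Section duality_functions.
Context d (T : measurableType d) (R : realType) (mu : {measure set T -> \bar R}).
Implicit Types (f g u : T -> R[i]) (p : \bar R).

Lemma conjugate_fin (r : R) : 1 < r ->
  hoelder_conjugate r%:E = (r / (r - 1))%:E.
Proof.
move=> r1; rewrite /hoelder_conjugate/= eqe gt_eqF ?(lt_trans ltr01)//.
by rewrite inver subr_eq0 gt_eqF// -EFinM.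
Qed.

Lemma normc_le_cLnormy f :
  \forall x \ae mu, ((normc (f x))%:E <= cLnorm mu +oo f)%E.
Proof.
rewrite /cLnorm unlock; case: ifPn => [mu0|].
  apply: filterS (ess_sup_ge mu (abse \o (fun x => (normc (f x))%:E))) => x /=.
  by rewrite ger0_norm ?normc_ge0.
rewrite -leNgt => mu0; exists setT; split => //.
by apply/eqP; rewrite eq_le mu0/=.
Qed.

Lemma cLnormy_le f (C : R) : 0 <= C ->
  (\forall x \ae mu, normc (f x) <= C) -> (cLnorm mu +oo f <= C%:E)%E.
Proof.
move=> C0 fC; rewrite /cLnorm unlock; case: ifPn => // mu0.
apply/ess_supP; apply: filterS fC => x /=.
by rewrite lee_fin ger0_norm ?normc_ge0.
Qed.

Lemma cLnorm1E f : cLnorm mu 1 f = (\int[mu]_x (normc (f x))%:E)%E.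
Proof.
rewrite /cLnorm Lnorm1; apply: eq_integral => x _.
by rewrite gee0_abs// lee_fin normc_ge0.
Qed.

Lemma cLnorm_powR f (r : R) : r != 0 ->
  (cLnorm mu r%:E f `^ r = \int[mu]_x (normc (f x) `^ r)%:E)%E.
Proof.
move=> r0; rewrite /cLnorm (poweR_Lnorm _ _ r0).
apply: eq_integral => x _.
by rewrite abse_EFin poweR_EFin ger0_norm ?normc_ge0.
Qed.

Lemma cLnorm_finE f (r : R) :
  (cLnorm mu r%:E f = (\int[mu]_x (normc (f x) `^ r)%:E) `^ r^-1)%E.
Proof.
rewrite /cLnorm unlock (eq_integral (fun x => (normc (f x) `^ r)%:E))// => x _.
by rewrite abse_EFin poweR_EFin ger0_norm ?normc_ge0.
Qed.

Lemma measurable_normcM f g : cmeasurable f -> cmeasurable g ->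
  measurable_fun setT (fun x => (normc (f x * g x))%:E).
Proof.
by move=> mf mg; apply/measurable_EFinP/measurable_normc/cmeasurableM.
Qed.

Lemma hoelder_y1 f g : cmeasurable f -> cmeasurable g ->
  (cLnorm mu +oo f < +oo)%E ->
  (\int[mu]_x (normc (f x * g x))%:E <= cLnorm mu +oo f * cLnorm mu 1 g)%E.
Proof.
move=> mf mg fy; rewrite cLnorm1E.
have f_fin : cLnorm mu +oo f \is a fin_num by rewrite ge0_fin_numE ?cLnorm_ge0.
have mng : measurable_fun setT (fun x => (normc (g x))%:E).
  exact/measurable_EFinP/measurable_normc.
rewrite -(fineK f_fin) -ge0_integralZl//; last 2 first.
  by move=> x _; rewrite lee_fin normc_ge0.
  by rewrite lee_fin fine_ge0// cLnorm_ge0.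
apply: ae_ge0_le_integral => //.
- by move=> x _; rewrite lee_fin normc_ge0.
- exact: measurable_normcM.
- by move=> x _; rewrite mule_ge0// ?lee_fin ?normc_ge0// fine_ge0// cLnorm_ge0.
- exact: measurable_funeM.
- apply: filterS (normc_le_cLnormy f) => x fx _.
  rewrite normcM EFinM; apply: lee_wpmul2r; first by rewrite lee_fin normc_ge0.
  by rewrite fineK.
Qed.

Lemma cHoelder p f g : (1 <= p)%E -> cmeasurable f -> cmeasurable g ->
  (cLnorm mu (hoelder_conjugate p) f < +oo)%E -> (cLnorm mu p g < +oo)%E ->
  (\int[mu]_x (normc (f x * g x))%:E <=
   cLnorm mu (hoelder_conjugate p) f * cLnorm mu p g)%E.
Proof.
move=> p1 mf mg; case: p p1 => [r||//].
- rewrite lee_fin le_eqVlt => /predU1P[<-|r1].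
    by rewrite hoelder_conjugate1 => fy _; exact: hoelder_y1.
  rewrite conjugate_fin// => _ _.
  have r0 : 0 < r by rewrite (lt_trans ltr01).
  have r10 : 0 < r - 1 by rewrite subr_gt0.
  have := @hoelder _ _ _ mu _ _ (r / (r - 1)) r
    (measurable_normc mf) (measurable_normc mg).
  rewrite Lnorm1; move=> H; apply: le_trans (H _ _ _).
  + rewrite le_eqVlt; apply/orP; left; apply/eqP; apply: eq_integral => x _ /=.
    by rewrite normcM ger0_norm ?mulr_ge0 ?normc_ge0.
  + by rewrite divr_gt0.
  + by [].
  + by field; rewrite !gt_eqF.
- rewrite hoelder_conjugatey => _ gy; rewrite muleC.
  by under eq_integral do rewrite mulrC; exact: hoelder_y1.
Qed.

(** The bound by [M] of the norm of the functional that [u] induces on L^q. Only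
real parts of pairings occur, which is enough since [f] may be rotated. *)
Definition dual_le p u (M : R) := forall f, cmeasurable f ->
  (cLnorm mu (hoelder_conjugate p) f < +oo)%E ->
  \int[mu]_x complex.Re (f x * u x) <=
    M * fine (cLnorm mu (hoelder_conjugate p) f).

Lemma Re_mul_csgn (k : R) (z : R[i]) :
  complex.Re ((k%:C)%C * csgn z * z) = k * normc z.
Proof. by rewrite -mulrA mul_csgn -rmorphM. Qed.

(** Tested on the conjugate phase of [u], of norm at most 1 in L^oo. *)
Lemma converse_hoelder1 u M : cmeasurable u -> 0 <= M ->
  dual_le 1%E u M -> fine (cLnorm mu 1 u) <= M.
Proof.
move=> mu_ M0; rewrite /dual_le hoelder_conjugate1 => H.
have sgn1 : (cLnorm mu +oo (fun x => csgn (u x)) <= 1)%E.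
  by apply: cLnormy_le => //; apply: aeW => x; exact: normc_csgn_le1.
have := H _ (cmeasurable_csgn mu_) (le_lt_trans sgn1 (ltry _)).
under eq_Rintegral do rewrite mul_csgn /=.
rewrite /Rintegral -cLnorm1E => /le_trans; apply.
rewrite -[leRHS]mulr1 ler_wpM2l// -lee_fin fineK// ge0_fin_numE ?cLnorm_ge0//.
exact: (le_lt_trans sgn1 (ltry _)).
Qed.

(** Tested on [f = csgn u * |u| ^ (r - 1)]: then [f * u = |u| ^ r], while
[|f| ^ q <= |u| ^ r] for the conjugate exponent [q = r / (r - 1)], so that
[N ^ r <= M * N ^ (r - 1)] with [N] the norm of [u]. *)
Lemma converse_hoelder_fin (r : R) u M : 1 < r -> cmeasurable u -> 0 <= M ->
  (cLnorm mu r%:E u < +oo)%E ->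
  dual_le r%:E u M -> fine (cLnorm mu r%:E u) <= M.
Proof.
move=> r1 mU M0 uoo; rewrite /dual_le conjugate_fin// => H.
have r0 : 0 < r by rewrite (lt_trans ltr01).
have r10 : 0 < r - 1 by rewrite subr_gt0.
pose f x := ((normc (u x) `^ (r - 1))%:C)%C * csgn (u x).
have mf : cmeasurable f.
  apply: cmeasurableM; last exact: cmeasurable_csgn.
  apply: cmeasurable_real.
  by apply: (measurableT_comp (measurable_powR _)); exact: measurable_normc.
have u_fin : cLnorm mu r%:E u \is a fin_num by rewrite ge0_fin_numE ?cLnorm_ge0.
set N := fine (cLnorm mu r%:E u) in H *.
have N0 : 0 <= N by rewrite fine_ge0// cLnorm_ge0.
have NE : (\int[mu]_x (normc (u x) `^ r)%:E = (N `^ r)%:E)%E.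
  by rewrite -cLnorm_powR ?gt_eqF// -(fineK u_fin) poweR_EFin.
have powM (a : R) : 0 <= a -> a `^ (r - 1) * a = a `^ r.
  move=> a0; rewrite -[X in _ * X]powRr1// -powRD ?subrK//.
  by rewrite (gt_eqF r0).
have fn : (cLnorm mu (r / (r - 1))%:E f <= (N `^ (r - 1))%:E)%E.
  rewrite cLnorm_finE.
  have -> : (N `^ (r - 1))%:E = ((N `^ r)%:E `^ (r / (r - 1))^-1)%E.
    rewrite poweR_EFin -powRrM; congr (_ `^ _)%:E.
    by field; rewrite !gt_eqF.
  rewrite -NE; apply: gt0_ler_poweR.
  - by rewrite invr_ge0 divr_ge0// ltW.
  - by rewrite in_itv/= leey andbT integral_ge0// => x _; rewrite lee_fin powR_ge0.
  - by rewrite in_itv/= leey andbT integral_ge0// => x _; rewrite lee_fin powR_ge0.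
  apply: ge0_le_integral => //.
  - by move=> x _; rewrite lee_fin powR_ge0.
  - apply/measurable_EFinP/(measurableT_comp (measurable_powR _)).
    exact: measurable_normc.
  - apply/measurable_EFinP/(measurableT_comp (measurable_powR _)).
    exact: measurable_normc.
  move=> x _; rewrite lee_fin.
  have -> : normc (u x) `^ r = (normc (u x) `^ (r - 1)) `^ (r / (r - 1)).
    rewrite -powRrM; congr (_ `^ _).
    by field; rewrite gt_eqF.
  apply: ge0_ler_powR; rewrite ?nnegrE ?normc_ge0 ?powR_ge0//.
    by rewrite divr_ge0// ltW.
  rewrite normcM normc_real ger0_norm ?powR_ge0//.
  by rewrite ler_piMr ?powR_ge0// normc_csgn_le1.
have foo := le_lt_trans fn (ltry _).
have := H f mf foo.
rewrite (_ : \int[mu]_x _ = N `^ r); last first.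
  rewrite /Rintegral -[RHS]/(fine (N `^ r)%:E) -NE; congr fine.
  by apply: eq_integral => x _; rewrite Re_mul_csgn powM ?normc_ge0.
have [N00 _|Nn0] := eqVneq N 0; first by rewrite N00.
have Np : 0 < N by rewrite lt_def Nn0.
move=> HN; rewrite -(ler_pM2r (powR_gt0 (r - 1) Np)).
rewrite [leLHS]mulrC powM//; apply: le_trans HN _.
rewrite ler_wpM2l// -lee_fin fineK//.
by rewrite ge0_fin_numE ?cLnorm_ge0.
Qed.

(** It is enough to bound |u| by [K = M + e] almost everywhere. The set where
[|u| > K] is covered by countably many subsets [G] of finite measure; the test
function [f = \1_G * (K / |u|) * csgn u] has [f * u = K * \1_G] and L^1 norm at
most [mu G], whence [K * mu G <= M * mu G] and [mu G = 0]. *)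
Lemma converse_hoelder_y u M : sigma_finite setT mu ->
  cmeasurable u -> 0 <= M -> dual_le +oo%E u M -> fine (cLnorm mu +oo u) <= M.
Proof.
move=> [F FT Ffin] mU M0; rewrite /dual_le hoelder_conjugatey => H.
apply/ler_addgt0Pr => e e0; set K := M + e.
have K0 : 0 < K by rewrite ltr_wpDl.
pose E := [set x | K < normc (u x)].
have mE : measurable E.
  rewrite -[E]setTI.
  have := measurable_normc mU measurableT (measurable_itv `]K, +oo[).
  by congr measurable; apply/seteqP; split => x /=; rewrite in_itv/= andbT.
have EF0 n : mu (E `&` F n) = 0%E.
  set G := E `&` F n.
  have [mFn Fnoo] := Ffin n.
  have mG : measurable G by exact: measurableI.
  have Gfin : mu G \is a fin_num.
    rewrite ge0_fin_numE//; apply: le_lt_trans Fnoo.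
    by apply: le_measure; rewrite ?inE//; apply: subIsetr.
  pose f x := ((\1_G x * (K * (normc (u x)) `^ (-1)))%:C)%C * csgn (u x).
  have fu x : complex.Re (f x * u x) = K * \1_G x.
    rewrite Re_mul_csgn indicE; case: (boolP (x \in G)) => [|_]; last first.
      by rewrite !(mul0r, mulr0).
    rewrite inE => -[Ex _]; rewrite mul1r mulr1 powR_inv1 ?normc_ge0// mulfVK//.
    by rewrite gt_eqF// (lt_trans K0).
  have mf : cmeasurable f.
    apply: cmeasurableM; last exact: cmeasurable_csgn.
    apply: cmeasurable_real; apply: measurable_funM; first exact: measurable_indic.
    apply: measurable_funM; first exact: measurable_cst.
    by apply: (measurableT_comp (measurable_powR _)); exact: measurable_normc.
  have fG : (cLnorm mu 1 f <= mu G)%E.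
    rewrite cLnorm1E -[G in leRHS]setIT -integral_indic//.
    apply: ge0_le_integral => //.
    - by move=> x _; rewrite lee_fin normc_ge0.
    - exact/measurable_EFinP/measurable_normc.
    - exact/measurable_EFinP/measurable_indic.
    move=> x _; rewrite lee_fin /f.
    have cx : 0 <= \1_G x * (K * normc (u x) `^ (-1)).
      by rewrite mulr_ge0// mulr_ge0 ?powR_ge0// ltW.
    rewrite normcM normc_real ger0_norm//.
    apply: le_trans (ler_piMr cx (normc_csgn_le1 _)) _.
    rewrite indicE; case: (boolP (x \in G)) => [|_]; last by rewrite !mul0r.
    rewrite inE => -[Ex _].
    rewrite mul1r powR_inv1 ?normc_ge0// ler_pdivrMr ?mul1r ?ltW//.
    exact: lt_trans K0 Ex.
  have foo : (cLnorm mu 1 f < +oo)%E.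
    by apply: le_lt_trans fG _; rewrite -ge0_fin_numE.
  have := H f mf foo.
  rewrite (_ : \int[mu]_x _ = K * fine (mu G)); last first.
    under eq_Rintegral do rewrite fu.
    rewrite /Rintegral; under eq_integral do rewrite EFinM.
    rewrite ge0_integralZl//; last 2 first.
    - exact/measurable_EFinP/measurable_indic.
    - by rewrite lee_fin ltW.
    by rewrite integral_indic// setIT fineM.
  move=> HG.
  have G0 : 0 <= fine (mu G) by exact: fine_ge0.
  have fG' : fine (cLnorm mu 1 f) <= fine (mu G).
    by rewrite fine_le// ge0_fin_numE ?cLnorm_ge0.
  have {}HG := le_trans HG (ler_wpM2l M0 fG').
  have {HG} HG : e * fine (mu G) <= 0.
    by move: HG; rewrite /K mulrDl gerDl.
  have : fine (mu G) <= 0 by rewrite -(pmulr_rle0 _ e0).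
  move=> G0'; rewrite -(fineK Gfin); congr EFin.
  by apply/eqP; rewrite eq_le G0 G0'.
have E0 : mu.-negligible E.
  rewrite -[E]setIT FT setI_bigcupr; apply: negligible_bigcup => n.
  exists (E `&` F n); split => //.
  by apply: measurableI => //; case: (Ffin n).
have uK : \forall x \ae mu, normc (u x) <= K.
  case: E0 => N [mN N0 EN]; exists N; split => // x /= /negP.
  by rewrite -ltNge => /EN.
have := cLnormy_le (ltW K0) uK.
rewrite -(fineK (_ : cLnorm mu +oo u \is a fin_num)) ?lee_fin//.
rewrite ge0_fin_numE ?cLnorm_ge0//.
exact: le_lt_trans (cLnormy_le (ltW K0) uK) (ltry _).
Qed.

Lemma converse_hoelder p u M : (1 <= p)%E -> sigma_finite setT mu ->
  cmeasurable u -> (cLnorm mu p u < +oo)%E -> 0 <= M ->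
  dual_le p u M -> fine (cLnorm mu p u) <= M.
Proof.
case: p => [r||//]; last by move=> _ sf mU _; exact: converse_hoelder_y.
rewrite lee_fin le_eqVlt => /predU1P[<-|r1] _ mU uoo M0 H.
  exact: converse_hoelder1.
exact: converse_hoelder_fin.
Qed.

End duality_functions.

(** * Duality between L^p and L^q *)

Section duality_Lp.
Context d (T : measurableType d) (R : realType) (mu : {measure set T -> \bar R}).
Context (p : \bar R) (p1 : (1 <= p)%E).
Local Notation q1 := (hoelder_conj_ge1 p1).
Implicit Types (f : Lp mu q1) (g u : Lp mu p1).

Lemma Lp_fin (p' : \bar R) (p1' : (1 <= p')%E) (w : Lp mu p1') :
  (cLnorm mu p' w < +oo)%E.
Proof. by rewrite -Lp_normE ltry. Qed.

Lemma integral_normc_pairing f g :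
  (\int[mu]_x (normc (f x * g x))%:E <= (`|f| * `|g|)%:E)%E.
Proof.
rewrite EFinM !Lp_normE; apply: cHoelder => //; try exact: Lp_meas; exact: Lp_fin.
Qed.

Lemma integrable_normc_pairing f g :
  mu.-integrable setT (fun x => (normc (f x * g x))%:E).
Proof.
apply/integrableP; split; first by apply: measurable_normcM; exact: Lp_meas.
apply: le_lt_trans (ltry (`|f| * `|g|)).
apply: le_trans (integral_normc_pairing f g).
rewrite le_eqVlt; apply/orP; left; apply/eqP; apply: eq_integral => x _ /=.
by rewrite ger0_norm ?normc_ge0.
Qed.

Lemma integrable_Re_pairing f g :
  mu.-integrable setT (fun x => (complex.Re (f x * g x))%:E).
Proof.
apply: le_integrable (integrable_normc_pairing f g) => //.
  apply/measurable_EFinP; have [] // : cmeasurable (fun x => f x * g x).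
  by apply: cmeasurableM; exact: Lp_meas.
by move=> x _; rewrite lee_fin (le_trans (Re_le_normc _))// ler_norm.
Qed.

Lemma Rintegral_Re_pairing_le f g :
  ((\int[mu]_x complex.Re (f x * g x))%:E <= \int[mu]_x (normc (f x * g x))%:E)%E.
Proof.
rewrite /Rintegral fineK; last exact: integrable_fin_num (integrable_Re_pairing f g).
apply: le_integral => //.
- exact: integrable_Re_pairing.
- exact: integrable_normc_pairing.
- by move=> x _; rewrite lee_fin (le_trans (ler_norm _))// Re_le_normc.
Qed.

Lemma Re_pairing_le f g : \int[mu]_x complex.Re (f x * g x) <= `|f| * `|g|.
Proof.
rewrite -lee_fin; apply: le_trans (integral_normc_pairing f g).
exact: Rintegral_Re_pairing_le.
Qed.

(** The hypothesis makes [Re (f * g')] nonnegative almost everywhere, so that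
both integrals compare through the integral of [|f * g|]. *)
Lemma Re_pairing_mono f g g' :
  (\forall x \ae mu, normc (f x * g x) <= complex.Re (f x * g' x)) ->
  \int[mu]_x complex.Re (f x * g x) <= \int[mu]_x complex.Re (f x * g' x).
Proof.
move=> gg'; rewrite -lee_fin; apply: le_trans (Rintegral_Re_pairing_le f g) _.
have mg' := integrable_Re_pairing f g'.
rewrite /Rintegral fineK; last exact: integrable_fin_num mg'.
have mRe := measurable_int mu mg'.
rewrite [leRHS](@ae_eq_integral _ _ _ _ _
  (fun x => `|(complex.Re (f x * g' x))%:E|%E))//.
- apply: ae_ge0_le_integral => //.
  + by move=> x _; rewrite lee_fin normc_ge0.
  + by apply: measurable_normcM; exact: Lp_meas.
  + exact: measurableT_comp.
  + by apply: filterS gg' => x gx _; rewrite lee_fin (le_trans gx)// ler_norm.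
- exact: measurableT_comp.
- by apply: filterS gg' => x gx _ /=; rewrite ger0_norm// (le_trans _ gx)// normc_ge0.
Qed.

Lemma Lp_norm_le_dual u (M : R) : sigma_finite setT mu -> 0 <= M ->
  (forall f, \int[mu]_x complex.Re (f x * u x) <= M * `|f|) -> `|u| <= M.
Proof.
move=> sf M0 H.
rewrite -[`|u|]/(fine _); apply: converse_hoelder => //.
- exact: Lp_meas.
- exact: Lp_fin.
move=> f mf foo.
have [w wf wn] := Lp_of_fun q1 mf foo.
rewrite -wn /=; apply: le_trans (H w).
rewrite le_eqVlt; apply/orP; left; apply/eqP; congr fine.
have mRe (k : T -> R[i]) : cmeasurable k ->
    measurable_fun setT (fun x => (complex.Re (k x * u x))%:E).
  move=> mk; apply/measurable_EFinP.
  have [] // : cmeasurable (fun x => k x * u x).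
  by apply: cmeasurableM => //; exact: Lp_meas.
apply: ae_eq_integral => //; [exact: mRe|by apply: mRe; exact: Lp_meas|].
by apply: filterS wf => x /(_ I) -> _.
Qed.

End duality_Lp.

(** * The two inequalities *)

Section adjoint.
Context d (T : measurableType d) (R : realType) (mu : {measure set T -> \bar R}).
Context (p : \bar R) (p1 : (1 <= p)%E) (m : nat).
Context (D : 'I_m -> {linear Lp mu p1 -> Lp mu p1}) (h : 'I_m -> Lp mu (leey 1%E)).
Hypothesis m_gt0 : (0 < m)%N.
Hypothesis Dh : forall i (u : Lp mu p1),
  (Lp_fun (D i u)) = (fun x => h i x * u x) %[ae mu].
Hypothesis prodD : forall u : Lp mu p1,
  (\big[(fun F G : Lp mu p1 -> Lp mu p1 => F \o G)/idfun]_(i < m) D i) u = u.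
Variable t : 'I_m -> R.
Hypothesis t_gt0 : forall i, 0 < t i.
Hypothesis prodt : \prod_i t i = 1.
Variables (A : {linear Lp mu p1 -> Lp mu p1}) (c : 'I_m -> R).
Hypothesis Ac : forall i (u : Lp mu p1), `|A (D i u)| <= c i * `|u|.
Hypothesis c_ge0 : forall i, 0 <= c i.
Hypothesis sf : sigma_finite setT mu.

(** The weighted mean cannot be inserted between [A] and [g] pointwise; it is
inserted on the other side of the duality, next to [B f], and moved back through
the adjunction. *)
Lemma adjoint_le_weighted_mean (g : Lp mu p1) : adjoint_op A ->
  `|A g| <= (\sum_i t i / m%:R * c i) * `|g|.
Proof.
move=> [B [_ BA]].
have w0 i : 0 <= t i / m%:R := weight_ge0 t_gt0 i.
have K0 : 0 <= \sum_i t i / m%:R * c i.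
  by apply: sumr_ge0 => i _; rewrite mulr_ge0.
have ReBA f g' : \int[mu]_x complex.Re (Lp_fun (B f) x * Lp_fun g' x) =
    \int[mu]_x complex.Re (Lp_fun f x * Lp_fun (A g') x).
  by have /(congr1 (@complex.Re R)) := BA f g'.
apply: Lp_norm_le_dual => //; first by rewrite mulr_ge0.
move=> f; rewrite -ReBA.
have [v vg vG] := weighted_rotation m_gt0 Dh prodD t_gt0 prodt (B f) g.
apply: le_trans (Re_pairing_mono vG) _; rewrite ReBA.
apply: le_trans (Re_pairing_le _ _) _; rewrite mulrC ler_wpM2r//.
rewrite linear_sum /= mulr_suml.
under [leRHS]eq_bigr do rewrite -mulrA.
under eq_bigr do rewrite linearZ.
apply: norm_Lp_sum_le => // i.
by apply: le_trans (Ac i _) _; rewrite ler_wpM2l.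
Qed.

End adjoint.

Theorem theorem2p1 (d : measure_display) (X : measurableType d) (R : realType)
    (mu : {sigma_finite_measure set X -> \bar R})
    (p : \bar R) (p1 : (1 <= p)%E)
    (m : nat) (m_gt0 : (0 < m)%N)
    (D : 'I_m -> {linear Lp mu p1 -> Lp mu p1})
    (mulD : forall i, multiplication_op (D i))
    (prodD : forall f : Lp mu p1,
      (\big[(fun F G : Lp mu p1 -> Lp mu p1 => F \o G)/idfun]_(i < m) D i) f = f)
    (A : {linear Lp mu p1 -> Lp mu p1}) (bndA : bounded_op A) :
  op_norm A ^+ m <= \prod_(i < m) op_norm (D i \o A) /\
  (adjoint_op A -> op_norm A ^+ m <= \prod_(i < m) op_norm (A \o D i)).
Proof.
have [h Dh] := choice mulD.
have [K K0 AK] : exists2 K, 0 <= K & forall u, `|A u| <= K * `|u|.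
  case: bndA => K AK; exists `|K| => // u.
  by apply: le_trans (AK u) _; rewrite ler_wpM2r// ler_norm.
split=> [|adjA]; apply: expr_le_prod_of_weighted_mean => //;
  try (by move=> *; exact: op_norm_ge0); try exact: op_norm_ge0.
- move=> t t0 t1; apply: op_norm_le.
    by apply: sumr_ge0 => i _; rewrite mulr_ge0 ?weight_ge0 ?op_norm_ge0.
  move=> u; apply: le_trans (norm_le_weighted_mean m_gt0 Dh prodD t0 t1 _) _.
  rewrite mulr_suml; apply: ler_sum => i _; rewrite -[leRHS]mulrA.
  apply: ler_wpM2l; first exact: weight_ge0.
  apply: (le_op_norm (F := D i \o A)).
    have [C C0 DC] := multiplication_bounded (mulD i).
    exists (C * K) => v /=; rewrite -mulrA.
    by apply: le_trans (DC _) _; rewrite ler_wpM2l.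
  by move=> c v /=; rewrite !linearZ.
- move=> t t0 t1; apply: op_norm_le.
    by apply: sumr_ge0 => i _; rewrite mulr_ge0 ?weight_ge0 ?op_norm_ge0.
  move=> u; apply: (adjoint_le_weighted_mean m_gt0 Dh prodD) => //.
  + move=> i v; apply: (le_op_norm (F := A \o D i)).
      have [C C0 DC] := multiplication_bounded (mulD i).
      exists (K * C) => w /=; rewrite -mulrA.
      by apply: le_trans (AK _) _; rewrite ler_wpM2l.
    by move=> c w /=; rewrite !linearZ.
  + by move=> i; exact: op_norm_ge0.
  + exact: sigma_finiteT.
Qed.
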